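(* Let $\lambda$ be a real number, $\alpha>0$, and let $X$ be a zero-truncated degenerate Poisson random variable with parameter $\alpha$. Then for every positive integer $n$, $$E\big[(X)_n\big]=\frac{1}{1-e_\lambda^{-1}(\alpha)}\sum_{k=1}^{n}\mathrm{Bel}_{k,\lambda}(\alpha)\,S_{1,\lambda}(n,k).$$
   Context: The falling factorial is $(x)_0=1$, $(x)_n=x(x-1)\cdots(x-n+1)$; the $\lambda$-falling factorial is $(x)_{0,\lambda}=1$, $(x)_{n,\lambda}=x(x-\lambda)\cdots(x-(n-1)\lambda)$ for $n\ge1$. The degenerate exponential is $e_\lambda^x(t)=\sum_{n\ge0}(x)_{n,\lambda}\frac{t^n}{n!}$ $(=(1+\lambda t)^{x/\lambda})$, $e_\lambda(t)=e_\lambda^1(t)$, $e_\lambda^{-1}(x)=1/e_\lambda(x)$; $\log_\lambda(1+t)=\frac1\lambda((1+t)^\lambda-1)$ is the compositional inverse of $e_\lambda(t)$ (for $\lambda=0$: $e^{xt}$, $\log(1+t)$). Degenerate Stirling numbers of the first kind: $\frac1{k!}(\log_\lambda(1+t))^k=\sum_{n\ge k}S_{1,\lambda}(n,k)\frac{t^n}{n!}$. A zero-truncated degenerate Poisson random variable with parameter $\alpha>0$ is a random variable $X$ with $P\{X=k\}=\frac{1}{e_\lambda(\alpha)-1}\frac{\alpha^k}{k!}(1)_{k,\lambda}$ for $k=1,2,3,\dots$. The degenerate Bell polynomials are defined by $e_\lambda^{-1}(x)e_\lambda\big(xe_\lambda(t)\big)=\sum_{n\ge0}\mathrm{Bel}_{n,\lambda}(x)\frac{t^n}{n!}$,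 equivalently $\mathrm{Bel}_{n,\lambda}(x)=\frac{1}{e_\lambda(x)}\sum_{k\ge0}\frac{x^k}{k!}(1)_{k,\lambda}(k)_{n,\lambda}$. *)

(* Defs.v *)
From HB Require Import structures.
From mathcomp Require Import all_boot all_order all_algebra.
From mathcomp Require Import all_classical all_reals all_analysis.

Set Implicit Arguments.
Unset Strict Implicit.
Unset Printing Implicit Defensive.

Import Order.TTheory GRing.Theory Num.Theory numFieldNormedType.Exports.

Local Open Scope classical_set_scope.
Local Open Scope ring_scope.

Definition ffalling {R : realType} (x : R) (n : nat) : R :=
  \prod_(i < n) (x - i%:R).

Definition dfalling {R : realType} (lambda x : R) (n : nat) : R :=
  \prod_(i < n) (x - i%:R * lambda).

(* e_lambda^x(t) as the sum of its defining series; the value is meaningful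
   only where the series converges. *)
Definition dexp {R : realType} (lambda x t : R) : R :=
  limn (pseries (fun n => dfalling lambda x n / n`!%:R) t).

(* This is log_lambda(u), so that log_lambda(1 + t) is [dlog lambda (1 + t)]. *)
Definition dlog {R : realType} (lambda u : R) : R :=
  if lambda == 0 then ln u else lambda^-1 * (u `^ lambda - 1).

Definition has_egf {R : realType} (f : R -> R) (a : nat -> R) : Prop :=
  \forall t \near (0 : R), pseries (fun n => a n / n`!%:R) t @ \oo --> f t.

(* The coefficients of f(t) = sum_n a_n t^n / n!; they are unique when they
   exist (see [egf_coefE]), and are 0 by convention otherwise. *)
Definition egf_coef {R : realType} (f : R -> R) : nat -> R :=
  xget (fun=> 0) [set a | has_egf f a].

Definition dstirling1 {R : realType} (lambda : R) (n k : nat) : R :=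
  egf_coef (fun t => dlog lambda (1 + t) ^+ k / k`!%:R) n.

Definition dbell {R : realType} (lambda : R) (n : nat) (x : R) : R :=
  egf_coef
    (fun t => (dexp lambda 1 x)^-1 * dexp lambda 1 (x * dexp lambda 1 t)) n.

(* The first condition says that the positive integers carry all the mass. *)
Definition zt_dpoisson {R : realType} {d : measure_display}
    {T : measurableType d} {P : probability T R}
    (lambda alpha : R) (X : {RV P >-> R}) : Prop :=
  P (X @^-1` [set k%:R | k in [set k : nat | (0 < k)%N]]) = 1%E /\
  forall k : nat, (0 < k)%N ->
    pmf X k%:R = (dexp lambda 1 alpha - 1)^-1
                 * (alpha ^+ k / k`!%:R) * dfalling lambda 1 k.

Section egf_unique.
Variable R : realType.
Implicit Types (f : R -> R) (a c : nat -> R).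

Let pseries_shift c t n :
  pseries c t n.+1 = c 0%N + t * pseries (fun i => c i.+1) t n.
Proof.
rewrite /pseries /series/= big_nat_recl// expr0 mulr1; congr +%R.
by rewrite mulr_sumr; apply: eq_bigr => i _; rewrite exprS mulrCA.
Qed.

Let cvg_pseries_shift c t l : t != 0 ->
  pseries c t @ \oo --> l ->
  pseries (fun i => c i.+1) t @ \oo --> t^-1 * (l - c 0%N).
Proof.
move=> t0 cl.
have -> : pseries (fun i => c i.+1) t =
    (fun n => t^-1 * (pseries c t n.+1 - c 0%N)).
  by apply/funext => n; rewrite pseries_shift addrC addKr mulKf.
apply: cvgM; first exact: cvg_cst.
apply: cvgB; last exact: cvg_cst.
by rewrite (cvg_shiftS (pseries c t)).
Qed.

Let pseries_eq0_coef0 c :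
  (\forall t \near (0 : R)^', pseries c t @ \oo --> (0 : R)) -> c 0%N = 0.
Proof.
move=> c0; have [r [r0 cr]] : exists r : R, r != 0 /\ pseries c r @ \oo --> 0.
  suff : \forall t \near (0 : R)^', t != 0 /\ pseries c t @ \oo --> 0.
    by move=> /filter_ex.
  by near=> t; split; near: t; [exact: nbhs_dnbhs_neq|exact: c0].
pose c' i := c i.+1.
have cvg' : cvgn (pseries (fun i => `|c' i|) (`|r| / 2)).
  apply: (@is_cvg_pseries_inside_norm _ _ r).
    by apply/cvg_ex; eexists; exact: cvg_pseries_shift cr.
  by rewrite ger0_norm ?divr_ge0// ltr_pdivrMr// ltr_pMr ?normr_gt0// ltr1n.
pose K := limn (pseries (fun i => `|c' i|) (`|r| / 2)).
have bndK t n : `|t| <= `|r| / 2 -> `|pseries c' t n| <= K.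
  move=> tr; apply: (@le_trans _ _ (pseries (fun i => `|c' i|) (`|r| / 2) n)).
    apply: le_trans (ler_norm_sum _ _ _) _; apply: ler_sum => i _.
    by rewrite normrM normrX ler_wpM2l// lerXn2r// nnegrE divr_ge0.
  apply: nondecreasing_cvgn_le => //; apply/nondecreasing_seqP => m.
  rewrite /pseries /series/= big_nat_recr//= lerDl.
  by rewrite mulr_ge0// exprn_ge0// divr_ge0.
have K0 : 0 <= K.
  by apply: le_trans (bndK 0 0%N _); rewrite ?normr0 ?divr_ge0.
apply/eqP; rewrite -normr_le0; apply/ler_addgt0Pr => e e0; rewrite add0r.
near (0 : R)^' => t.
have t0 : t != 0 by near: t; exact: nbhs_dnbhs_neq.
have ct : pseries c t @ \oo --> 0 by near: t; exact: c0.
have tr : `|t| <= `|r| / 2.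
  near: t; apply: dnbhs0_le.
  by rewrite divr_gt0// normr_gt0.
have te : `|t| <= e / (K + 1).
  near: t; apply: dnbhs0_le.
  by rewrite divr_gt0// ltr_wpDl.
have /cvg_norm c't := cvg_pseries_shift t0 ct.
have : `|t^-1 * (0 - c 0%N)| <= K.
  rewrite -(cvg_lim (@norm_hausdorff _ _) c't).
  apply: limr_le; first by apply/cvg_ex; eexists; exact: c't.
  by near=> n; exact: bndK.
rewrite sub0r normrM normrN normfV mulrC ler_pdivrMr ?normr_gt0// => /le_trans.
apply; apply: (@le_trans _ _ ((K + 1) * (e / (K + 1)))).
  by rewrite ler_pM// lerDl.
by rewrite mulrC divfK// gt_eqF// ltr_wpDl.
Unshelve. all: by end_near. Qed.

Let pseries_eq0 c :
  (\forall t \near (0 : R)^', pseries c t @ \oo --> (0 : R)) ->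
  forall n, c n = 0.
Proof.
move=> c0 n; elim: n c c0 => [|n IH] c c0; first exact: pseries_eq0_coef0.
apply: (IH (fun i => c i.+1)); near=> t.
have t0 : t != 0 by near: t; exact: nbhs_dnbhs_neq.
have ct : pseries c t @ \oo --> 0 by near: t; exact: c0.
have := cvg_pseries_shift t0 ct.
by rewrite (pseries_eq0_coef0 c0) subrr mulr0.
Unshelve. all: by end_near. Qed.

Lemma has_egf_unique f a b : has_egf f a -> has_egf f b -> a = b.
Proof.
move=> fa fb; apply/funext => n; apply/eqP; rewrite -subr_eq0.
suff /eqP : (a n - b n) / n`!%:R = 0.
  by rewrite mulf_eq0 invr_eq0 pnatr_eq0 -[_ == 0%N]negbK -lt0n fact_gt0 orbF.
apply: (@pseries_eq0 (fun n => (a n - b n) / n`!%:R)).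
near=> t.
have at' : pseries (fun n => a n / n`!%:R) t @ \oo --> f t.
  by near: t; apply: nbhs_dnbhs; exact: fa.
have bt : pseries (fun n => b n / n`!%:R) t @ \oo --> f t.
  by near: t; apply: nbhs_dnbhs; exact: fb.
rewrite -(subrr (f t)).
have -> : pseries (fun n => (a n - b n) / n`!%:R) t =
    pseries (fun n => a n / n`!%:R) t - pseries (fun n => b n / n`!%:R) t.
  apply/funext => m; rewrite /pseries /series !fctE/= -sumrB.
  by apply: eq_bigr => i _; rewrite !mulrBl.
exact: cvgB.
Unshelve. all: by end_near. Qed.

Lemma egf_coefE f a : has_egf f a -> egf_coef f = a.
Proof.
by move=> fa; apply: xget_unique => // b fb; exact: has_egf_unique fb fa.
Qed.

End egf_unique.

(* Main.v *)
(* Write (x)_n = sum_k s(n,k) (x)_{k,lambda} with s given by the recurrence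
   s(n+1,k) = s(n,k-1) + (k lambda - n) s(n,k). This recurrence says that
   sum_n s(n,k) t^n/n! and log_lambda(1+t)^k/k! solve the same first order
   linear differential equation, so s(n,k) = S_{1,lambda}(n,k). By linearity it
   remains to see that Bel_{k,lambda}(alpha) is (1 - e_lambda(alpha)^-1) times
   E[(X)_{k,lambda}]. For t near 0 and v = e_lambda(t),
   e_lambda(alpha v) = 1 + (e_lambda(alpha) - 1) E[v^X], and
   v^X = e_lambda^X(t) = sum_n (X)_{n,lambda} t^n/n! may be integrated termwise,
   its partial sums being dominated by e_{-|lambda|}(|t|)^X.
   For the latter to be integrable, alpha must lie strictly inside the disc of
   convergence of e_lambda: the total mass 1 of the nonnegative weights forces
   lambda = 1/m (a finite sum), or lambda <= 0 and |lambda| alpha < 1. *)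

Require Import Defs.
From HB Require Import structures.
From mathcomp Require Import all_boot all_order all_algebra.
From mathcomp Require Import all_classical all_reals all_analysis.
From mathcomp Require Import measurable_realfun.
From mathcomp Require Import ring lra.

Set Implicit Arguments.
Unset Strict Implicit.
Unset Printing Implicit Defensive.

Import Order.TTheory GRing.Theory Num.Theory numFieldNormedType.Exports.

Local Open Scope classical_set_scope.
Local Open Scope ring_scope.

(** * Power series with geometrically bounded coefficients *)

Section geometric_growth.
Variable R : realType.
Implicit Types (a : nat -> R) (r t : R).

(** A quantitative stand-in for a radius of convergence of at least 1/r, stable under termwise
    differentiation up to a larger ratio. *)
Definition geom_bounded a r := exists M, forall n, `|a n| <= M * r ^+ n.

Lemma geom_bounded_cvg a r t :
  geom_bounded a r -> 0 < r -> r * `|t| < 1 -> cvgn (pseries a t).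
Proof.
move=> [M aM] r0 rt; apply: normed_cvg.
apply: (@series_le_cvg _ _ (geometric M (r * `|t|))).
- by move=> n; exact: normr_ge0.
- move=> n; rewrite geometric_ge0 ?mulr_ge0 ?(ltW r0)//.
  by have := aM 0%N; rewrite expr0 mulr1; exact: le_trans.
- move=> n /=; rewrite normrM normrX exprMn mulrA ler_wpM2r// exprn_ge0.
- by apply: is_cvg_geometric_series; rewrite ger0_norm// mulr_ge0// ltW.
Qed.

(** The factor n + 1 produced by differentiation is absorbed by 2^n, hence the doubled ratio. *)
Lemma geom_bounded_diffs a r :
  geom_bounded a r -> 0 < r -> geom_bounded (pseries_diffs a) (2 * r).
Proof.
move=> [M aM] r0; exists (M * r) => n.
rewrite /pseries_diffs normrM ger0_norm//.
apply: (@le_trans _ _ (2 ^+ n * (M * r ^+ n.+1))).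
  apply: ler_pM => //; rewrite -natrX ler_nat; exact: ltn_expl.
by rewrite exprMn exprS; lra.
Qed.

Lemma is_derive_pseries a r t : geom_bounded a r -> 0 < r ->
    4 * r * `|t| < 1 ->
  is_derive t (1 : R) (fun x => limn (pseries a x))
    (limn (pseries (pseries_diffs a) t)).
Proof.
(* [pseries_snd_diffs] wants the series and its first two derived series to converge at a point
   beyond t. The second derived series has ratio 4r, so K is the midpoint of |t| and 1/(4r). *)
move=> ar r0 rt; pose K := (`|t| + (4 * r)^-1) / 2.
have tr : `|t| < (4 * r)^-1.
  by rewrite -[ltRHS]mul1r ltr_pdivlMr ?mulr_gt0// mulrC.
have K0 : 0 < K by rewrite divr_gt0// ltr_wpDl// invr_gt0 mulr_gt0.
have tK : `|t| < `|K| by rewrite (gtr0_norm K0) /K; lra.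
have Kr : 4 * r * `|K| < 1.
  by rewrite (gtr0_norm K0) mulrC -ltr_pdivlMr ?mulr_gt0// mul1r /K; lra.
have ar2 := geom_bounded_diffs ar r0.
have r2 : 0 < 2 * r by rewrite mulr_gt0.
have ar4 := geom_bounded_diffs ar2 r2.
have rK : 0 <= r * `|K| by rewrite mulr_ge0// ltW.
apply: (@pseries_snd_diffs _ a K) => //.
- apply: (geom_bounded_cvg ar) => //; lra.
- apply: (geom_bounded_cvg ar2) => //; lra.
- apply: (geom_bounded_cvg ar4) => //; lra.
Qed.

Lemma geom_bounded_ratio a r N : 0 < r ->
  (forall n, (N <= n)%N -> `|a n.+1| <= r * `|a n|) -> geom_bounded a r.
Proof.
(* M dominates each normalised term up to index N; from there on the ratio bound propagates the
   estimate. *)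
move=> r0 aN; pose M := \sum_(i < N.+1) `|a i| / r ^+ i.
exists M; elim => [|n IH].
  rewrite expr0 mulr1 /M big_ord_recl/= expr0 divr1 lerDl sumr_ge0// => i _.
  by rewrite divr_ge0// exprn_ge0// ltW.
have [Nn|nN] := leqP N n.
  by rewrite (le_trans (aN _ Nn))// exprS mulrCA ler_pM2l.
rewrite -ler_pdivrMr ?exprn_gt0// /M (bigD1 (Ordinal (nN : n.+1 < N.+1)%N))//=.
by rewrite lerDl sumr_ge0// => i _; rewrite divr_ge0// exprn_ge0// ltW.
Qed.

Lemma pseries0 a : limn (pseries a 0) = a 0%N.
Proof.
apply: cvg_lim => //; rewrite -cvg_shiftS.
rewrite (_ : (fun n => _) = (fun=> a 0%N)); first exact: cvg_cst.
apply/funext => n; rewrite /pseries /series/= big_nat_recl//= expr0 mulr1.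
by rewrite big1 ?addr0// => i _; rewrite expr0n mulr0.
Qed.

Lemma cvg_pseries_shift a t : cvgn (pseries (fun i => a i.+1) t) ->
  pseries a t @ \oo --> a 0%N + t * limn (pseries (fun i => a i.+1) t).
Proof.
move=> ct; rewrite -cvg_shiftS.
rewrite (_ : (fun n => _) =
    (fun n => a 0%N + t * pseries (fun i => a i.+1) t n)).
  by apply: cvgD; [exact: cvg_cst|apply: cvgM => //; exact: cvg_cst].
apply/funext => n; rewrite /pseries /series/= big_nat_recl//= expr0 mulr1.
by rewrite mulr_sumr; congr (_ + _); apply: eq_bigr => i _;
  rewrite exprS mulrCA.
Qed.

End geometric_growth.

(** * Uniqueness for first order linear differential equations *)

Section linear_ode.
Variable R : realType.
Implicit Types (f h v q : R -> R) (r t : R).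

Lemma is_derive0_cst f r t :
  (forall x, `|x| < r -> is_derive x (1 : R) f 0) -> `|t| < r -> f t = f 0.
Proof.
move=> df tr.
have r0 : 0 < r by exact: le_lt_trans tr.
have cf x : `|x| < r -> {for x, continuous f}.
  move=> /df [+ _] => /derivable1_diffP; exact: differentiable_continuous.
have [t0|t0] := leP 0 t.
- have H x : x \in `[0, t] -> `|x| < r.
    by rewrite in_itv/= => /andP[x0 xt];
      rewrite ger0_norm// (le_lt_trans xt)// (le_lt_trans (ler_norm _) tr).
  have [| |c _] := @MVT_segment _ f (fun=> 0) 0 t t0.
  - by move=> x x0t; apply/df/H/subset_itv_oo_cc.
  - apply: continuous_in_subspaceT => x; rewrite inE => /H; exact: cf.
  - by rewrite mul0r => /eqP; rewrite subr_eq0 => /eqP.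
- have H x : x \in `[t, 0] -> `|x| < r.
    rewrite in_itv/= => /andP[tx x0]; rewrite ler0_norm//.
    by apply: le_lt_trans tr; rewrite ltr0_norm// lerN2.
  have [| |c _] := @MVT_segment _ f (fun=> 0) t 0 (ltW t0).
  - by move=> x x0t; apply/df/H/subset_itv_oo_cc.
  - apply: continuous_in_subspaceT => x; rewrite inE => /H; exact: cf.
  - by rewrite mul0r => /eqP; rewrite subr_eq0 => /eqP.
Qed.

(** Here v is an integrating factor: (hv)' = qhv - qhv = 0. Applied to a difference h of two
    solutions with h(0) = 0, it gives h = 0 wherever v does not vanish. *)
Lemma dual_ode_mul_cst {h v q r t} :
  (forall x, `|x| < r -> is_derive x (1 : R) h (q x * h x)) ->
  (forall x, `|x| < r -> is_derive x (1 : R) v (- q x * v x)) ->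
  `|t| < r -> h t * v t = h 0 * v 0.
Proof.
move=> dh dv tr; apply: (@is_derive0_cst (fun x => h x * v x) _ _ _ tr) => x xr.
have [? ?] := (dh x xr, dv x xr).
apply: is_derive_eq; rewrite /GRing.scale/=; ring.
Qed.

End linear_ode.

(** * Growth of the degenerate falling factorials *)

Section degenerate.
Variable R : realType.
Implicit Types (lambda x t : R).

Lemma dfallingS lambda x n :
  dfalling lambda x n.+1 = dfalling lambda x n * (x - n%:R * lambda).
Proof. by rewrite /dfalling big_ord_recr. Qed.

Lemma dfalling0 lambda x : dfalling lambda x 0 = 1.
Proof. by rewrite /dfalling big_ord0. Qed.

Lemma dfalling_coefS lambda x n :
  dfalling lambda x n.+1 / n.+1`!%:R =
    dfalling lambda x n / n`!%:R * ((x - n%:R * lambda) / n.+1%:R).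
Proof.
by rewrite dfallingS factS natrM invfM; ring.
Qed.

(** Consecutive coefficients have ratio (x - n lambda)/(n + 1), of absolute value at most r as soon
    as n (r - |lambda|) >= |x|. *)
Lemma geom_bounded_dfalling lambda x r :
  `|lambda| < r -> geom_bounded (fun n => dfalling lambda x n / n`!%:R) r.
Proof.
move=> lr; have r0 : 0 < r by exact: le_lt_trans lr.
pose N := Num.bound (`|x| / (r - `|lambda|)).
apply: (@geom_bounded_ratio _ _ _ N) => // n Nn.
rewrite dfalling_coefS normrM mulrC ler_wpM2r// normrM normfV.
rewrite (ger0_norm (ler0n _ n.+1)) ler_pdivrMr//.
apply: le_trans (ler_normB _ _) _; rewrite normrM ger0_norm//.
have : `|x| / (r - `|lambda|) <= n%:R.
  apply: (@le_trans _ _ N%:R); last by rewrite ler_nat.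
  by rewrite ltW// archi_boundP// divr_ge0// subr_ge0 ltW.
rewrite ler_pdivrMr ?subr_gt0// -natr1; lra.
Qed.

End degenerate.

(** * Linear combinations of series and the Euler operator *)

Section pseries_algebra.
Variable R : realType.
Implicit Types (a b : nat -> R) (t : R).

Lemma cvg_pseries_lincomb a b t (c d A B : R) :
  pseries a t @ \oo --> A -> pseries b t @ \oo --> B ->
  pseries (fun n => c * a n + d * b n) t @ \oo --> c * A + d * B.
Proof.
move=> aA bB.
rewrite (_ : pseries _ t = (fun n => c * pseries a t n + d * pseries b t n)).
  by apply: cvgD; apply: cvgM => //; exact: cvg_cst.
apply/funext => n; rewrite /pseries /series/= !mulr_sumr -big_split/=.
by apply: eq_bigr => i _; rewrite mulrDl !mulrA.
Qed.

Lemma cvg_pseries_euler a t : cvgn (pseries (pseries_diffs a) t) ->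
  pseries (fun n => n%:R * a n) t @ \oo
    --> t * limn (pseries (pseries_diffs a) t).
Proof.
by move=> ct; have := @cvg_pseries_shift _ (fun n => n%:R * a n) t ct;
  rewrite mul0r add0r.
Qed.

End pseries_algebra.

(** * The degenerate exponential near 0 *)

Section degenerate_exponential.
Variable R : realType.
Implicit Types (lambda x t : R).

(* Any radius depending on lambda alone would do: [dexp_natr] is used for all k
   at a fixed t. The factor 4 leaves room for two termwise derivatives, each of
   which doubles the ratio in [geom_bounded_diffs]. *)
Definition dexp_radius lambda : R := (4 * (`|lambda| + 1))^-1.

Lemma dexp_radius_gt0 lambda : 0 < dexp_radius lambda.
Proof. by rewrite invr_gt0 mulr_gt0// ltr_wpDl. Qed.

Lemma near0_dexp_radius lambda :
  \forall t \near (0 : R), `|t| < dexp_radius lambda.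
Proof. exact: nbhs0_lt (dexp_radius_gt0 lambda). Qed.

Lemma lt_dexp_radius lambda t :
  `|t| < dexp_radius lambda -> 4 * (`|lambda| + 1) * `|t| < 1.
Proof.
by rewrite -[ltRHS]mul1r ltr_pdivlMr ?mulr_gt0 ?ltr_wpDl// mulrC.
Qed.

Lemma lt_dexp_radius_1Dgt0 lambda t : `|t| < dexp_radius lambda -> 0 < 1 + t.
Proof.
move=> /lt_dexp_radius tr.
have lt0 : 0 <= `|lambda| * `|t| by rewrite mulr_ge0.
have : - `|t| <= t by rewrite lerNl ler_normr lexx orbT.
lra.
Qed.

Lemma lt_dexp_radius_1DMgt0 lambda t :
  `|t| < dexp_radius lambda -> 0 < 1 + lambda * t.
Proof.
move=> /lt_dexp_radius tr.
have : - `|lambda * t| <= lambda * t by rewrite lerNl ler_normr lexx orbT.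
have := normr_ge0 t.
rewrite normrM; have : 0 <= `|lambda| * `|t| by rewrite mulr_ge0.
lra.
Qed.

Lemma lt_dexp_radius_normM lambda t :
  `|t| < dexp_radius lambda -> `|lambda * t| < 1.
Proof.
move=> /lt_dexp_radius; have := normr_ge0 t; rewrite normrM.
have : 0 <= `|lambda| * `|t| by rewrite mulr_ge0.
lra.
Qed.

Lemma cvg_pseries_dexp_radius (a : nat -> R) lambda t :
  geom_bounded a (`|lambda| + 1) -> `|t| < dexp_radius lambda ->
  cvgn (pseries a t) /\ cvgn (pseries (pseries_diffs a) t).
Proof.
move=> ga /lt_dexp_radius tr; have l1 : 0 < `|lambda| + 1 by rewrite ltr_wpDl.
have lt0 : 0 <= (`|lambda| + 1) * `|t| by rewrite mulr_ge0// ltW.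
split; first by apply: (geom_bounded_cvg ga) => //; lra.
apply: (geom_bounded_cvg (geom_bounded_diffs ga l1)); last by lra.
by rewrite mulr_gt0.
Qed.

Lemma cvg_dexp lambda x t : `|lambda * t| < 1 ->
  pseries (fun n => dfalling lambda x n / n`!%:R) t @ \oo --> dexp lambda x t.
Proof.
move=> lt1.
have [->|t0] := eqVneq t 0.
  suff: cvgn (pseries (fun n => dfalling lambda x n / n`!%:R) 0) by [].
  apply: (@geom_bounded_cvg _ _ (`|lambda| + 1)).
  - by apply: geom_bounded_dfalling; rewrite ltrDl.
  - by rewrite ltr_wpDl.
  - by rewrite normr0 mulr0.
have t1 : `|lambda| < `|t|^-1.
  by rewrite -[ltRHS]mul1r ltr_pdivlMr ?normr_gt0// -normrM.
(* The ratio must exceed |lambda| and stay below 1/|t|; the midpoint does. *)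
apply: (@geom_bounded_cvg _ _ ((`|lambda| + `|t|^-1) / 2)).
- by apply: geom_bounded_dfalling; lra.
- by have := normr_ge0 lambda; lra.
- rewrite -ltr_pdivlMr ?normr_gt0//; lra.
Qed.

Lemma dexp0 lambda x : dexp lambda x 0 = 1.
Proof. by rewrite /dexp pseries0 dfalling0 fact0 divr1. Qed.

(** The coefficients satisfy (n + 1) a_{n+1} = x a_n - lambda n a_n, that is f' = x f - lambda t f',
    which is solved for f'. *)
Lemma is_derive_dexp lambda x t : `|t| < dexp_radius lambda ->
  is_derive t (1 : R) (dexp lambda x) (x / (1 + lambda * t) * dexp lambda x t).
Proof.
move=> tr; have tr4 := lt_dexp_radius tr.
have l1 : 0 < `|lambda| + 1 by rewrite ltr_wpDl.
pose a n := dfalling lambda x n / n`!%:R.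
have ga : geom_bounded a (`|lambda| + 1).
  by apply: geom_bounded_dfalling; rewrite ltrDl.
have [ca cda] := cvg_pseries_dexp_radius ga tr.
have dE : pseries_diffs a = (fun n => x * a n + - lambda * (n%:R * a n)).
  apply/funext => n; rewrite /pseries_diffs /a dfalling_coefS.
  by field; rewrite nat1r !pnatr_eq0 -lt0n fact_gt0.
have L : limn (pseries (pseries_diffs a) t) =
    x * dexp lambda x t + - lambda * (t * limn (pseries (pseries_diffs a) t)).
  rewrite {1}dE; apply: cvg_lim => //; apply: cvg_pseries_lincomb.
    exact: ca.
  exact: cvg_pseries_euler.
have d1 : 1 + lambda * t != 0 by rewrite gt_eqF// lt_dexp_radius_1DMgt0.
rewrite (_ : _ * _ = limn (pseries (pseries_diffs a) t)).
  exact: is_derive_pseries ga l1 tr4.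
apply: (mulfI d1); transitivity (x * dexp lambda x t); [by field|lra].
Qed.

(** The equations for x and -x are dual. In particular [dexp lambda x] has no zero here, so it can
    serve as an integrating factor. *)
Lemma dexpN lambda x t : `|t| < dexp_radius lambda ->
  dexp lambda x t * dexp lambda (- x) t = 1.
Proof.
move=> tr; pose q t := x / (1 + lambda * t).
transitivity (dexp lambda x 0 * dexp lambda (- x) 0);
  last by rewrite !dexp0 mulr1.
apply: (@dual_ode_mul_cst _ _ _ q (dexp_radius lambda)) => //.
- by move=> y yr; exact: is_derive_dexp.
- by move=> y yr; rewrite -mulNr; exact: is_derive_dexp.
Qed.

Lemma is_derive_exprn (f : R -> R) n x (df : R) : is_derive x (1 : R) f df ->
  is_derive x (1 : R) (fun y => f y ^+ n) (n%:R * f x ^+ n.-1 * df).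
Proof.
move=> dfx; rewrite (_ : (fun y => _) = f ^+ n).
  by apply: is_derive_eq.
by apply/funext => y; elim: n => [|n IH]; rewrite ?expr0// !exprS IH.
Qed.

(** Both sides solve y' = k y / (1 + lambda t) with y(0) = 1. *)
Lemma dexp_natr lambda k t : `|t| < dexp_radius lambda ->
  dexp lambda k%:R t = dexp lambda 1 t ^+ k.
Proof.
move=> tr; pose q t := k%:R / (1 + lambda * t).
pose h t := dexp lambda k%:R t - dexp lambda 1 t ^+ k.
pose v := dexp lambda (- k%:R).
have : h t * v t = 0.
  transitivity (h 0 * v 0); last by rewrite /h !dexp0 expr1n subrr mul0r.
  apply: (@dual_ode_mul_cst _ h v q (dexp_radius lambda)) => //.
  - move=> y yr; have ? := is_derive_dexp k%:R yr.
    have ? := is_derive_exprn k (is_derive_dexp 1 yr).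
    apply: is_derive_eq; rewrite /q /h.
    (* k = 0 is separate because [k.-1] truncates there. *)
    case: (k) => [|k']; first by rewrite !mul0r subrr.
    by rewrite exprS/=; ring.
  - by move=> y yr; rewrite /q -mulNr; exact: is_derive_dexp.
move=> /eqP; rewrite mulf_eq0 => /orP[|/eqP v0].
  by rewrite subr_eq0 => /eqP.
by have := dexpN k%:R tr; rewrite -/(v t) v0 mulr0 => /esym/eqP;
  rewrite oner_eq0.
Qed.

End degenerate_exponential.

(** * Degenerate Stirling numbers of the first kind *)

Section degenerate_stirling.
Variable R : realType.
Implicit Types (lambda x t : R).

Fixpoint stirling1_rec lambda n k : R :=
  match n, k with
  | 0, 0 => 1
  | 0, _.+1 => 0
  | n'.+1, 0 => - n'%:R * stirling1_rec lambda n' 0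
  | n'.+1, k'.+1 => stirling1_rec lambda n' k'
      + (k%:R * lambda - n'%:R) * stirling1_rec lambda n' k
  end.

Local Notation s := stirling1_rec.

Lemma stirling1_rec_gt lambda n k : (n < k)%N -> s lambda n k = 0.
Proof.
elim: n k => [|n IH] [|k]//= nk; rewrite !IH ?mulr0 ?addr0//.
exact: ltnW.
Qed.

Lemma stirling1_recS0 lambda n : s lambda n.+1 0 = 0.
Proof. by elim: n => [|n /= ->]; rewrite /= ?oppr0 ?mul0r ?mulr0. Qed.

(** Induction on n: the new factor is split as x - n = (x - k lambda) + (k lambda - n); the first
    part raises (x)_{k,lambda} to index k + 1, the second keeps k. *)
Lemma ffallingE lambda x n :
  ffalling x n = \sum_(0 <= k < n.+1) s lambda n k * dfalling lambda x k.
Proof.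
elim: n => [|n IH].
  by rewrite big_nat1 dfalling0 mulr1 /ffalling big_ord0.
rewrite /ffalling big_ord_recr/= -/(ffalling x n) IH.
transitivity (\sum_(0 <= k < n.+1) s lambda n k * dfalling lambda x k.+1 +
  \sum_(0 <= k < n.+1)
    (k%:R * lambda - n%:R) * s lambda n k * dfalling lambda x k).
  rewrite mulr_suml -big_split/=; apply: eq_bigr => k _.
  by rewrite dfallingS; ring.
rewrite [in RHS]big_nat_recl//= [X in _ + X]big_nat_recl//=.
rewrite addrCA; congr (_ + _); first by rewrite mul0r sub0r.
rewrite [X in _ = X](_ : _ = \sum_(0 <= k < n.+1)
  (s lambda n k * dfalling lambda x k.+1 +
   (k.+1%:R * lambda - n%:R) * s lambda n k.+1 * dfalling lambda x k.+1)).
  rewrite big_split/=; congr (_ + _).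
  (* The right-hand sum has one more term, which contains s(n, n + 1) = 0. *)
  by rewrite [RHS]big_nat_recr//= stirling1_rec_gt// mulr0 mul0r addr0.
by apply: eq_bigr => k _; rewrite mulrDl.
Qed.

(** By induction |s(n,k)| <= (|lambda| + 1)^n n!: for k <= n + 1 the recurrence multiplies the bound
    by at most 1 + (n + 1)|lambda| + n = (n + 1)(|lambda| + 1). *)
Lemma geom_bounded_stirling1 lambda k :
  geom_bounded (fun n => s lambda n k / n`!%:R) (`|lambda| + 1).
Proof.
exists 1 => n; rewrite mul1r normrM normfV (ger0_norm (ler0n _ _)).
rewrite ler_pdivrMr ?ltr0n ?fact_gt0//.
have l0 := normr_ge0 lambda.
elim: n k => [|n IH] k.
  by rewrite expr0 mul1r fact0; case: k => [|k]/=; rewrite ?normr1 ?normr0.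
have [nk|kn] := ltnP n.+1 k.
  by rewrite stirling1_rec_gt// normr0 mulr_ge0 ?exprn_ge0// addr_ge0.
pose M := (`|lambda| + 1) ^+ n * n`!%:R.
have M0 : 0 <= M by rewrite mulr_ge0 ?exprn_ge0// addr_ge0.
rewrite (_ : _ * _ = n.+1%:R * (`|lambda| + 1) * M); last first.
  by rewrite exprS factS natrM /M; ring.
case: k kn => [|k] kn /=.
  rewrite normrM normrN (ger0_norm (ler0n _ n)); apply: ler_pM => //.
  by have := ler0n R n; rewrite -natr1; nra.
have nkl : `|k.+1%:R * lambda - n%:R| <= n.+1%:R * `|lambda| + n%:R.
  rewrite (le_trans (ler_normB _ _))// normrM (ger0_norm (ler0n _ k.+1))
    (ger0_norm (ler0n _ n)) lerD2r.
  by rewrite ler_wpM2r// ler_nat.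
apply: (@le_trans _ _ (M + (n.+1%:R * `|lambda| + n%:R) * M)).
  rewrite (le_trans (ler_normD _ _))// normrM lerD//.
  by rewrite ler_pM//.
by rewrite -natr1; lra.
Qed.

Lemma is_derive_1D t : is_derive t (1 : R) (fun y => 1 + y) 1.
Proof. by apply: is_derive_eq; rewrite add0r mulr1. Qed.

(** Writing (1 + t)^(lambda - 1) through [dlog] itself covers lambda = 0 and makes the equations for
    the powers of [dlog] linear. *)
Lemma is_derive_dlog lambda t : 0 < 1 + t ->
  is_derive t (1 : R) (fun t => dlog lambda (1 + t))
    ((1 + lambda * dlog lambda (1 + t)) / (1 + t)).
Proof.
move=> t0; rewrite /dlog; have [->|l0] := eqVneq lambda 0.
  rewrite mul0r addr0 mul1r.
  have dln := is_derive1_ln t0.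
  have ds := is_derive_1D t.
  have := @is_derive1_comp _ (@ln R) (fun t => 1 + t) t _ _ dln ds.
  by rewrite mulr1.
have dp := @is_derive1_powR _ lambda (1 + t) t0.
have ds := is_derive_1D t.
have dc := @is_derive1_comp _ (@powR R ^~ lambda) (fun t => 1 + t) t _ _ dp ds.
rewrite /comp/= in dc.
apply: is_derive_eq.
rewrite /GRing.scale/= powRB; last by rewrite (gt_eqF t0) implybT.
rewrite powRr1 ?ltW//.
by field; rewrite gt_eqF.
Qed.

Lemma dlog1 lambda : dlog lambda 1 = 0.
Proof. by rewrite /dlog ln1 powR1 subrr mulr0 if_same. Qed.

(** Induction on k, because the k-th function is the inhomogeneous term of the equation for the next
    one. It cancels in the difference of the two solutions, for which (1 + t)^(-(k + 1) lambda) is a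
    positive integrating factor. *)
Lemma stirling1_rec_egf lambda k t : `|t| < dexp_radius lambda ->
  limn (pseries (fun n => s lambda n k / n`!%:R) t) =
  dlog lambda (1 + t) ^+ k / k`!%:R.
Proof.
elim: k t => [|k IH] t tr.
  rewrite expr0 fact0 divr1; apply: cvg_lim => //; rewrite -cvg_shiftS.
  rewrite (_ : (fun n => _) = (fun=> 1)); first exact: cvg_cst.
  apply/funext => n; rewrite /pseries /series/= big_nat_recl//= big1.
    by rewrite expr0 fact0 divr1 mulr1 addr0.
  by move=> i _; rewrite -[- _ * _]/(s lambda i.+1 0) stirling1_recS0 !mul0r.
pose f j t := dlog lambda (1 + t) ^+ j / j`!%:R.
pose a n := s lambda n k.+1 / n`!%:R.
pose g t := limn (pseries a t).
have l1 : 0 < `|lambda| + 1 by rewrite ltr_wpDl.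
have dg y : `|y| < dexp_radius lambda -> is_derive y (1 : R) g
    ((f k y + k.+1%:R * lambda * g y) / (1 + y)).
  move=> yr; have yr4 := lt_dexp_radius yr.
  have ga := geom_bounded_stirling1 lambda k.+1.
  have [ck _] := cvg_pseries_dexp_radius (geom_bounded_stirling1 lambda k) yr.
  have [ca cda] := cvg_pseries_dexp_radius ga yr.
  (* The recurrence, read on series: g' = f_k + (k + 1) lambda g - y g'. *)
  have dE : pseries_diffs a = (fun n => 1 * (1 * (s lambda n k / n`!%:R)
      + (k.+1%:R * lambda) * a n) + -1 * (n%:R * a n)).
    apply/funext => n; rewrite /pseries_diffs /a/= factS natrM.
    by field; rewrite ?nat1r !pnatr_eq0 -lt0n fact_gt0.
  have L : limn (pseries (pseries_diffs a) y) =
     1 * (1 * f k y + (k.+1%:R * lambda) * g y)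
     + -1 * (y * limn (pseries (pseries_diffs a) y)).
    rewrite {1}dE; apply: cvg_lim => //; apply: cvg_pseries_lincomb; last first.
      exact: cvg_pseries_euler.
    apply: cvg_pseries_lincomb; last exact: ca.
    by rewrite /f -IH//; exact: ck.
  have y1 : 1 + y != 0 by rewrite gt_eqF// (lt_dexp_radius_1Dgt0 yr).
  rewrite (_ : _ / _ = limn (pseries (pseries_diffs a) y)).
    exact: is_derive_pseries ga l1 yr4.
  by apply: (mulIf y1); rewrite mulfVK//; lra.
have df y : `|y| < dexp_radius lambda -> is_derive y (1 : R) (f k.+1)
    ((f k y + k.+1%:R * lambda * f k.+1 y) / (1 + y)).
  move=> yr; have y0 := lt_dexp_radius_1Dgt0 yr.
  have dl := is_derive_exprn k.+1 (is_derive_dlog lambda y0).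
  rewrite /f/= in dl *.
  have -> : (fun t => dlog lambda (1 + t) ^+ k.+1 / k.+1`!%:R) =
    (fun t => (k.+1`!%:R)^-1 * dlog lambda (1 + t) ^+ k.+1).
    by apply/funext => z; rewrite mulrC.
  apply: is_derive_eq; rewrite /GRing.scale/= exprS factS natrM.
  by field; rewrite ?nat1r !pnatr_eq0 (gt_eqF y0) -lt0n fact_gt0.
pose q y := k.+1%:R * lambda / (1 + y).
pose h y := g y - f k.+1 y.
pose v y := (1 + y) `^ (- (k.+1%:R * lambda)).
have : h t * v t = 0.
  transitivity (h 0 * v 0); last first.
    by rewrite /h /g /f pseries0 /a/= addr0 dlog1 exprS !mul0r subrr mul0r.
  apply: (@dual_ode_mul_cst _ h v q (dexp_radius lambda)) => //.
  - move=> y yr; have ? := dg y yr; have ? := df y yr.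
    by apply: is_derive_eq; rewrite /q /h; ring.
  - move=> y yr; have y0 := lt_dexp_radius_1Dgt0 yr.
    have dp := @is_derive1_powR _ (- (k.+1%:R * lambda)) (1 + y) y0.
    have ds := is_derive_1D y.
    have dc := @is_derive1_comp _ (@powR R ^~ _) (fun t => 1 + t) y _ _ dp ds.
    apply: (is_derive_eq dc).
    rewrite /q /v powRB; last by rewrite (gt_eqF y0) implybT.
    by rewrite powRr1 ?ltW//; field; rewrite gt_eqF.
move=> /eqP; rewrite mulf_eq0 => /orP[|].
  by rewrite subr_eq0 => /eqP.
by rewrite gt_eqF// powR_gt0// (lt_dexp_radius_1Dgt0 tr).
Qed.

Lemma dstirling1E lambda n k : dstirling1 lambda n k = stirling1_rec lambda n k.
Proof.
rewrite /dstirling1 (@egf_coefE _ _ (fun n => s lambda n k))//.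
near=> t.
have tr : `|t| < dexp_radius lambda by near: t; exact: near0_dexp_radius.
rewrite -stirling1_rec_egf//.
by have [] := cvg_pseries_dexp_radius (geom_bounded_stirling1 lambda k) tr.
Unshelve. all: by end_near. Qed.

End degenerate_stirling.

(** * Constraints on the parameters *)

Section parameter.
Variable R : realType.
Variables (lambda alpha : R).
Hypothesis alpha0 : 0 < alpha.

Let c k : R := dfalling lambda 1 k / k`!%:R.

(** Once N lambda > 1, the factor 1 - N lambda is negative, so a positive (1)_{N,lambda} would have
    a negative successor. *)
Lemma dfalling_ge0_eventually0 : 0 < lambda ->
  (forall k, 0 <= dfalling lambda 1 k) ->
  exists N, forall k, (N <= k)%N -> dfalling lambda 1 k = 0.
Proof.
move=> l0 d0; exists (Num.bound lambda^-1).+1 => k.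
elim: k => [//|k IH]; rewrite leq_eqVlt => /predU1P[[<-]|Nk]; last first.
  by rewrite dfallingS IH// mul0r.
set N := Num.bound _; rewrite dfallingS.
have lN : lambda^-1 < N%:R by rewrite archi_boundP// invr_ge0 ltW.
have n1 : 1 - N%:R * lambda < 0 by rewrite subr_lt0 -ltr_pdivrMr// mul1r.
have [->|dN] := eqVneq (dfalling lambda 1 N) 0; first by rewrite mul0r.
have := d0 N.+1; rewrite dfallingS pmulr_rge0; first by rewrite leNgt n1.
by rewrite lt_neqAle eq_sym dN d0.
Qed.

(** The ratio of consecutive terms is alpha (1 - (k + 1) lambda)/(k + 2) >= (k + 1)/(k + 2), the
    ratio of the harmonic series. *)
Lemma dfalling_coef_ge_harmonic k : 1 <= - lambda * alpha ->
  alpha / k.+1%:R <= c k.+1 * alpha ^+ k.+1.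
Proof.
move=> la; elim: k => [|k IH].
  by rewrite /c dfalling_coefS dfalling0 fact0 mul0r subr0 expr1 !divr1 !mul1r.
rewrite exprS /c dfalling_coefS -/(c k.+1).
apply: (@le_trans _ _ (alpha / k.+1%:R * (k.+1%:R / k.+2%:R))).
  by rewrite mulrA mulfVK.
rewrite [leRHS](_ : _ = c k.+1 * alpha ^+ k.+1 *
  (alpha * (1 - k.+1%:R * lambda) / k.+2%:R)); last by ring.
apply: ler_pM => //.
- by rewrite divr_ge0// ltW.
- rewrite ler_wpM2r ?invr_ge0//.
  have : 0 <= k.+1%:R * (- lambda * alpha - 1) by rewrite mulr_ge0// subr_ge0.
  by move: (k.+1%:R) => K K0; move: alpha0; nra.
Qed.

(** Comparison with the harmonic series also excludes the boundary - lambda alpha = 1; the strict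
    inequality leaves room for exponential moments. *)
Lemma cvg_pseries_parameter : cvgn (pseries c alpha) ->
  lambda <= 0 -> - lambda * alpha < 1.
Proof.
move=> cc l0; rewrite ltNge; apply/negP => la.
apply: (@dvg_harmonic R).
rewrite -[X in cvgn X](_ :
    (fun n => alpha^-1 * series (fun k => alpha / k.+1%:R) n) = _); last first.
  apply/funext => n; rewrite /series/= mulr_sumr; apply: eq_bigr => i _.
  by rewrite mulKf// gt_eqF.
apply: is_cvgM; first exact: is_cvg_cst.
apply: (@series_le_cvg _ _ (fun k => c k.+1 * alpha ^+ k.+1)).
- by move=> n; rewrite divr_ge0// ltW.
- move=> n; apply: le_trans (dfalling_coef_ge_harmonic n la).
  by rewrite divr_ge0// ltW.
- by move=> n; exact: dfalling_coef_ge_harmonic.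
have -> : series (fun k => c k.+1 * alpha ^+ k.+1) =
    (fun n => pseries c alpha n.+1 - c 0%N).
  apply/funext => n; rewrite /pseries /series/= [in RHS]big_nat_recl//=.
  by rewrite expr0 mulr1 addrC addKr.
apply: is_cvgB; last exact: is_cvg_cst.
apply/cvg_ex; exists (limn (pseries c alpha)).
by rewrite (cvg_shiftS (pseries c alpha)); exact: cc.
Qed.

Lemma geom_bounded_parameter :
  (forall k, 0 <= dfalling lambda 1 k) -> cvgn (pseries c alpha) ->
  exists2 r, 0 < r /\ r * alpha < 1 & geom_bounded c r.
Proof.
move=> d0 cc; have [l0|l0] := leP lambda 0; last first.
  have [N dN] := dfalling_ge0_eventually0 l0 d0.
  have r0 : 0 < (2 * alpha)^-1 by rewrite invr_gt0 mulr_gt0.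
  (* The coefficients vanish eventually, so any positive ratio bounds them; this one gives r alpha =
     1/2. *)
  exists (2 * alpha)^-1.
    by split => //; rewrite invfM mulfVK ?gt_eqF// invf_lt1// ltr1n.
  apply: (@geom_bounded_ratio _ _ _ N) => // n Nn.
  by rewrite /c (dN n.+1 (leqW Nn)) mul0r normr0 mulr_ge0// ltW.
have la := cvg_pseries_parameter cc l0.
have la' : - lambda < alpha^-1 by rewrite -[ltRHS]mul1r ltr_pdivlMr.
(* The midpoint of |lambda| and 1/alpha. *)
exists ((- lambda + alpha^-1) / 2).
  split; first lra.
  by rewrite -ltr_pdivlMr// mul1r; lra.
by apply: geom_bounded_dfalling; rewrite ler0_norm//; lra.
Qed.

End parameter.

(** * Expectations of a variable carried by the positive integers *)

Section discrete_expectation.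
Context (R : realType) (d : measure_display) (T : measurableType d)
  (P : probability T R) (X : {RV P >-> R}).
Hypothesis PX : P (X @^-1` [set k%:R | k in [set k : nat | (0 < k)%N]]) = 1%E.

Let A k := X @^-1` [set k.+1%:R : R].

Let measurableA k : measurable (A k).
Proof. exact: measurable_funPTI. Qed.

Let trivIsetA : trivIset setT A.
Proof.
apply/trivIsetP => i j _ _ ij; apply/seteqP; split => // w;
  rewrite /A => -[/= -> /eqP].
by rewrite eqr_nat eqSS (negbTE ij).
Qed.

Let bigcupA :
  X @^-1` [set k%:R | k in [set k : nat | (0 < k)%N]] = \bigcup_k A k.
Proof.
apply/seteqP; split => w /=.
  by move=> [[//|k] _ kX]; exists k.
by move=> [k _ /= Xk]; exists k.+1.
Qed.

Let PA k : P (A k) = (pmf X k.+1%:R)%:E.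
Proof. by rewrite /pmf fineK// fin_num_measure. Qed.

Let P_bigcupC : P (~` \bigcup_k A k) = 0%E.
Proof.
rewrite probability_setC; last exact: bigcupT_measurable.
by rewrite -bigcupA PX subee.
Qed.

Lemma ae_natr : {ae P, forall w, exists k : nat, X w = k%:R}.
Proof.
exists (~` \bigcup_k A k); split => //.
  exact/measurableC/bigcupT_measurable.
by move=> w /= Xw [k _ Xk]; apply: Xw; exists k.+1.
Qed.

Lemma cvg_series_pmf : series (fun k => pmf X k.+1%:R) @ \oo --> (1 : R).
Proof.
have h : (fun n => \sum_(0 <= i < n) P (A i))%E @ \oo --> 1%E.
  by rewrite -PX bigcupA; exact: measure_sigma_additive.
move/fine_cvg: h.
rewrite (_ : fine \o _ = series (fun k => pmf X k.+1%:R)) //.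
apply/funext => n /=; rewrite /series/=.
by under eq_bigr do rewrite PA; rewrite sumEFin.
Qed.

(** The complement of the sets [A k] is null, and the integrand is constant on each of them. *)
Lemma ge0_expectation_nat (g : R -> R) (l : R) :
  measurable_fun setT g -> (forall x, 0 <= g x) ->
  series (fun k => g k.+1%:R * pmf X k.+1%:R) @ \oo --> l ->
  (\int[P]_w (g (X w))%:E = l%:E)%E.
Proof.
move=> mg g0 gl.
have mgX : measurable_fun setT (EFin \o (g \o X)).
  by apply/measurable_EFinP; exact: measurableT_comp.
have mU : measurable (\bigcup_k A k) by exact: bigcupT_measurable.
rewrite (@ge0_negligible_integral _ _ _ _ _ (~` \bigcup_k A k))//; last 2 first.
- exact: measurableC.
- by move=> w _; rewrite lee_fin.
rewrite setTD setCK ge0_integral_bigcup//; last 2 first.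
- exact: measurable_funTS.
- by move=> w _; rewrite lee_fin.
apply: cvg_lim => //.
rewrite (_ : (fun n => _) =
    EFin \o series (fun k => g k.+1%:R * pmf X k.+1%:R)).
  by apply: cvg_EFin => //; apply: nearW.
apply/funext => n; rewrite /series/= -sumEFin; apply: eq_bigr => k _.
rewrite (eq_integral (cst (g k.+1%:R)%:E)).
  by rewrite integral_cst//= PA.
by move=> w; rewrite inE /A/= => ->.
Qed.

End discrete_expectation.

(** * Domination of the partial sums *)

Section dominated_falling.
Variable R : realType.
Implicit Types (lambda x t : R).

(** Factor by factor, |k - i lambda| <= k + i |lambda|. *)
Lemma norm_dfalling_le lambda (k n : nat) :
  `|dfalling lambda k%:R n| <= dfalling (- `|lambda|) k%:R n.
Proof.
rewrite /dfalling normr_prod; apply: ler_prod => i _; rewrite normr_ge0/=.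
rewrite (le_trans (ler_normB _ _))// normrM !normr_nat.
by rewrite mulrN opprK.
Qed.

(** The bound is uniform in n and a pure k-th power, so it yields a dominating function of the form
    M^X. *)
Lemma norm_pseries_dfalling_le lambda t (k n : nat) :
  `|t| < dexp_radius (- `|lambda|) ->
  `|pseries (fun n => dfalling lambda k%:R n / n`!%:R) t n|
    <= dexp (- `|lambda|) 1 `|t| ^+ k.
Proof.
move=> tr; have tr' : `| `|t| | < dexp_radius (- `|lambda|) by rewrite normr_id.
rewrite -dexp_natr//.
pose b m := dfalling (- `|lambda|) k%:R m / m`!%:R.
have b0 m : 0 <= b m.
  by rewrite divr_ge0// (le_trans _ (norm_dfalling_le lambda k m)).
apply: (@le_trans _ _ (pseries b `|t| n)).
  rewrite (le_trans (ler_norm_sum _ _ _))//; apply: ler_sum => i _.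
  rewrite !normrM normrX normfV normr_nat ler_wpM2r ?exprn_ge0//.
  by rewrite ler_wpM2r ?invr_ge0// norm_dfalling_le.
apply: nondecreasing_cvgn_le.
  apply/nondecreasing_seqP => m.
  by rewrite /pseries /series/= big_nat_recr//= lerDl mulr_ge0// exprn_ge0.
apply/cvg_ex; eexists; apply: cvg_dexp.
exact: lt_dexp_radius_normM.
Qed.

Lemma dexp_cvg0 lambda x : dexp lambda x s @[s --> (0 : R)] --> (1 : R).
Proof.
rewrite -[X in _ --> X](dexp0 lambda x).
have := @is_derive_dexp _ lambda x 0.
rewrite normr0 => /(_ (dexp_radius_gt0 lambda)) [+ _] => /derivable1_diffP.
exact: differentiable_continuous.
Qed.

Lemma near0_normr (Q : R -> Prop) : (\forall s \near (0 : R), Q s) ->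
  \forall t \near (0 : R), Q `|t|.
Proof.
move=> /nbhs_ballP[e /= e0 eQ]; apply/nbhs_ballP; exists e => //= t.
by rewrite /ball/= !sub0r !normrN => te; apply: eQ;
  rewrite /ball/= sub0r normrN normr_id.
Qed.

End dominated_falling.

Lemma measurable_powR_exp (R : realType) (u : R) : 0 < u ->
  measurable_fun setT (powR u).
Proof.
move=> u0; rewrite (_ : powR u = expR \o (fun x => x * ln u)).
  apply: measurableT_comp => //; exact: measurable_funM.
by apply/funext => x; rewrite /powR gt_eqF.
Qed.

(** * Degenerate factorial moments of the zero-truncated law *)

Section zero_truncated_poisson.
Context (R : realType) (d : measure_display) (T : measurableType d)
  (P : probability T R) (lambda alpha : R) (X : {RV P >-> R}).
Hypothesis alpha0 : 0 < alpha.
Hypothesis hX : zt_dpoisson lambda alpha X.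

Let c k : R := dfalling lambda 1 k / k`!%:R.
Let D := dexp lambda 1 alpha.
Let mass k := (D - 1)^-1 * (alpha ^+ k.+1 * c k.+1).

Let pmfE k : pmf X k.+1%:R = mass k.
Proof. by rewrite hX.2// /mass /c; ring. Qed.

Let cvg_mass : series mass @ \oo --> (1 : R).
Proof.
by have := cvg_series_pmf hX.1; under eq_fun do rewrite pmfE.
Qed.

Let mass_ge0 k : 0 <= mass k.
Proof. by rewrite -pmfE pmf_ge0. Qed.

(** If D were 1, the convention 0^-1 = 0 would make every mass vanish, against total mass 1. The
    sign of D - 1 is then read off from P(X = 1) = alpha/(D - 1) >= 0. *)
Lemma zt_dpoisson_dexp_gt1 : 1 < D.
Proof.
have D1 : D - 1 != 0.
  apply/eqP => D0; have := cvg_mass.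
  rewrite (_ : series mass = (fun=> 0)).
    move=> /(cvg_unique _ (cvg_cst _)) => /(_ (@norm_hausdorff _ _))/esym/eqP.
    by rewrite oner_eq0.
  by apply/funext => n; rewrite /series/= big1// => i _;
    rewrite /mass D0 invr0 mul0r.
have := mass_ge0 0; rewrite /mass /c dfallingS dfalling0 mul0r subr0 divr1
  !mulr1 expr1.
by rewrite pmulr_lge0// invr_ge0 subr_ge0 le_eqVlt eq_sym -subr_eq0 (negbTE D1).
Qed.

Let D1_gt0 : 0 < D - 1. Proof. by rewrite subr_gt0 zt_dpoisson_dexp_gt1. Qed.

Let dfalling_ge0 k : 0 <= dfalling lambda 1 k.
Proof.
case: k => [|k]; first by rewrite dfalling0.
have := mass_ge0 k; rewrite /mass pmulr_rge0 ?invr_gt0// pmulr_rge0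
  ?exprn_gt0//.
by rewrite /c pmulr_lge0// invr_gt0 ltr0n fact_gt0.
Qed.

(** [dexp] is only a [limn], so convergence at alpha has to be proved: the partial sums are 1 + (D -
    1) times those of [mass], which tend to 1. *)
Let cvg_c : cvgn (pseries c alpha).
Proof.
apply/cvg_ex; exists (1 + (D - 1) * 1).
rewrite -(cvg_shiftS (pseries c alpha)).
rewrite (_ : (fun n => _) = (fun n => 1 + (D - 1) * series mass n)).
  by apply: cvgD; [exact: cvg_cst|apply: cvgM => //; exact: cvg_cst].
apply/funext => n; rewrite /pseries /series/= big_nat_recl//= mulr_sumr.
rewrite expr0 mulr1 /c dfalling0 fact0 divr1; congr (_ + _).
by apply: eq_bigr => i _; rewrite /mass mulrA mulfV ?gt_eqF// mul1r mulrC.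
Qed.

Lemma zt_dpoisson_radius :
  exists2 r, 0 < r /\ r * alpha < 1 & geom_bounded c r.
Proof. exact: geom_bounded_parameter. Qed.

(** The probability generating function: u^k merges with alpha^k, and the truncation at 0 removes
    the constant term 1. *)
Lemma integral_powR_zt_dpoisson r u : geom_bounded c r -> 0 < r ->
  0 < u -> r * alpha * u < 1 ->
  (\int[P]_w (u `^ X w)%:E
    = ((D - 1)^-1 * (dexp lambda 1 (alpha * u) - 1))%:E)%E.
Proof.
move=> cr r0 u0 ru.
apply: (ge0_expectation_nat hX.1 (g := powR u)).
- exact: measurable_powR_exp.
- by move=> x; exact: powR_ge0.
rewrite (_ : series _ =
    (fun n => (D - 1)^-1 * (pseries c (alpha * u) n.+1 - 1))).
  apply: cvgM; first exact: cvg_cst.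
  apply: cvgB; last exact: cvg_cst.
  rewrite (cvg_shiftS (pseries c (alpha * u))).
  suff: cvgn (pseries c (alpha * u)) by [].
  apply: (geom_bounded_cvg cr) => //.
  by rewrite gtr0_norm ?mulr_gt0// mulrA.
apply/funext => n; rewrite /pseries /series/= big_nat_recl//= expr0 mulr1.
have -> : c 0%N = 1 by rewrite /c dfalling0 fact0 divr1.
rewrite [1 + _]addrC addrK mulr_sumr; apply: eq_bigr => i _.
by rewrite pmfE powR_mulrn ?ltW// /mass exprMn; ring.
Qed.

Let m n : R := fine (\int[P]_w (dfalling lambda (X w) n)%:E)%E.

(** Collects what makes both v^X and the dominating M^X integrable, where v = e_lambda(t) and M =
    e_{-|lambda|}(|t|). *)
Let good r t :=
  [/\ `|t| < dexp_radius lambda, `|t| < dexp_radius (- `|lambda|),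
     0 < dexp lambda 1 t /\ r * alpha * dexp lambda 1 t < 1 &
     0 < dexp (- `|lambda|) 1 `|t|
       /\ r * alpha * dexp (- `|lambda|) 1 `|t| < 1].

(** Both exponentials tend to 1 at 0, while r alpha < 1. *)
Let near_good r : r * alpha < 1 -> 0 < r -> \forall t \near (0 : R), good r t.
Proof.
move=> ra r0.
have ra0 : 0 < r * alpha by rewrite mulr_gt0.
have H l : \forall t \near (0 : R),
    0 < dexp l 1 t /\ r * alpha * dexp l 1 t < 1.
  have [h1 h2] : (\forall t \near (0 : R), 0 < dexp l 1 t) /\
      (\forall t \near (0 : R), dexp l 1 t < (r * alpha)^-1).
    split.
      exact: (cvgr_gt _ (@dexp_cvg0 _ l 1)).
    by apply: (cvgr_lt _ (@dexp_cvg0 _ l 1)); rewrite invf_gt1.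
  near=> t; split; first by near: t.
  by rewrite mulrC -ltr_pdivlMr// mul1r; near: t.
near=> t; split; near: t.
- exact: near0_dexp_radius.
- exact: near0_dexp_radius.
- exact: H.
- exact: (near0_normr (H _)).
Unshelve. all: by end_near. Qed.

Let measurable_dfallingX n :
  measurable_fun setT (fun w => dfalling lambda (X w) n).
Proof.
by apply: measurable_prod => i _; apply: measurable_funB.
Qed.

Let measurable_powRX u : 0 < u ->
  measurable_fun setT (fun w => (u `^ X w)%:E : \bar R).
Proof.
move=> u0; apply/measurable_EFinP/(measurableT_comp (measurable_powR_exp u0)).
exact: measurable_funPT.
Qed.

Let integrable_powR u r : geom_bounded c r -> 0 < r ->
  0 < u -> r * alpha * u < 1 ->
  P.-integrable setT (fun w => (u `^ X w)%:E).
Proof.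
move=> cr r0 u0 ru; apply/integrableP; split; first exact: measurable_powRX.
under eq_integral do rewrite gee0_abs ?lee_fin ?powR_ge0//.
by rewrite (integral_powR_zt_dpoisson cr)// ltry.
Qed.

(** A single term of the series is a difference of two consecutive partial sums, each at most M^k in
    absolute value; hence |(k)_{n,lambda}| <= 2 n! M^k / |t|^n for a fixed small t different from
    0. *)
Lemma integrable_dfalling n :
  P.-integrable setT (fun w => (dfalling lambda (X w) n)%:E).
Proof.
have [r [r0 ra] cr] := zt_dpoisson_radius.
near (0 : R)^' => t.
have t0 : t != 0 by near: t; exact: nbhs_dnbhs_neq.
have [_ tr _ [M0 Mr]] : good r t.
  by near: t; apply: nbhs_dnbhs; exact: near_good.
set M := dexp _ _ _ in M0 Mr.
have mf : measurable_fun setT (fun w => (dfalling lambda (X w) n)%:E : \bar R).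
  exact/measurable_EFinP.
pose C := 2 * n`!%:R / `|t| ^+ n.
pose g w := (C%:E * (M `^ X w)%:E)%E.
have ig : P.-integrable setT g.
  by apply: integrableZl => //; exact: (integrable_powR cr).
(* With a constant sequence, dominated convergence acts as a comparison criterion for
   integrability. *)
have [| |//] := @dominated_convergence _ _ _ P setT measurableT
  (fun=> (fun w => (dfalling lambda (X w) n)%:E)) _ g (fun=> mf) mf _ ig.
- by apply: aeW => w _; exact: cvg_cst.
- apply: filterS (ae_natr hX.1) => w [k Xk] _ _.
  rewrite /g Xk (powR_mulrn _ (ltW M0)) -EFinM abse_EFin lee_fin.
  pose S j := pseries (fun n => dfalling lambda k%:R n / n`!%:R) t j.
  have S2 : `|S n.+1 - S n| <= 2 * M ^+ k.
    rewrite (le_trans (ler_normB _ _))// mulr_natl mulr2n lerD//;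
      exact: norm_pseries_dfalling_le.
  have SE : S n.+1 - S n = dfalling lambda k%:R n / n`!%:R * t ^+ n.
    by rewrite /S /pseries /series/= big_nat_recr//= [X in X - _]addrC addrK.
  rewrite SE !normrM normfV normr_nat normrX in S2.
  rewrite /C [leRHS](_ : _ = 2 * M ^+ k * (n`!%:R / `|t| ^+ n)); last by ring.
  rewrite -ler_pdivrMr; last first.
    by rewrite divr_gt0 ?exprn_gt0 ?normr_gt0// ltr0n fact_gt0.
  by rewrite invf_div mulrA mulrAC.
Unshelve. all: by end_near. Qed.

Lemma cvg_pseries_dfalling_moment : \forall t \near (0 : R),
  pseries (fun n => m n / n`!%:R) t @ \oo
    --> (D - 1)^-1 * (dexp lambda 1 (alpha * dexp lambda 1 t) - 1).
Proof.
have [r [r0 ra] cr] := zt_dpoisson_radius.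
near=> t.
have [tl tr [v0 vr] [M0 Mr]] : good r t.
  by near: t; exact: near_good.
set M := dexp _ _ _ in M0 Mr; set v := dexp _ _ t in v0 vr *.
pose f_ N w := (pseries (fun n => dfalling lambda (X w) n / n`!%:R) t N)%:E.
have f_E N w : f_ N w = \sum_(0 <= n < N)
    ((t ^+ n / n`!%:R)%:E * (dfalling lambda (X w) n)%:E)%E.
  rewrite /f_ /pseries /series/= -sumEFin; apply: eq_bigr => i _.
  by rewrite -EFinM; congr EFin; ring.
have if_ N : P.-integrable setT (f_ N).
  rewrite (_ : f_ N = (fun w => \sum_(0 <= n < N)
    ((t ^+ n / n`!%:R)%:E * (dfalling lambda (X w) n)%:E)%E)).
    apply: integrable_sum => // i _; apply: integrableZl => //.
    exact: integrable_dfalling.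
  by apply/funext => w; exact: f_E.
have [] := @dominated_convergence _ _ _ P setT measurableT f_
  (fun w => (v `^ X w)%:E) (fun w => (M `^ X w)%:E).
- by move=> N; exact: measurable_int (if_ N).
- exact: measurable_powRX.
- apply: filterS (ae_natr hX.1) => w [k Xk] _.
  (* At an integer value k of X, v^k is e_lambda^k(t), the sum of the series. *)
  rewrite /f_ Xk powR_mulrn ?ltW// -dexp_natr//.
  apply: cvg_EFin; first exact: nearW.
  exact/cvg_dexp/lt_dexp_radius_normM.
- exact: integrable_powR cr _ _ _.
- apply: filterS (ae_natr hX.1) => w [k Xk] N _.
  rewrite /f_ Xk (powR_mulrn _ (ltW M0)) abse_EFin lee_fin.
  exact: norm_pseries_dfalling_le.
move=> _ _; rewrite (integral_powR_zt_dpoisson cr)//.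
move=> /fine_cvg.
rewrite (_ : fine \o _ = pseries (fun n => m n / n`!%:R) t)//.
apply/funext => N /=.
under eq_integral do rewrite f_E.
rewrite integral_sum//; last first.
  by move=> i; apply: integrableZl => //; exact: integrable_dfalling.
rewrite /pseries /series/=.
rewrite (eq_bigr (fun i => (m i / i`!%:R * t ^+ i)%:E)) ?sumEFin// => i _.
rewrite integralZl//; last exact: integrable_dfalling.
rewrite -[in LHS](@fineK _ (integral _ _ _)).
  by rewrite -EFinM; congr EFin; rewrite -/(m i); ring.
exact: integrable_fin_num (integrable_dfalling i).
Unshelve. all: by end_near. Qed.

Lemma dbell_zt_dpoisson n : (0 < n)%N ->
  (1 - D^-1)^-1 * dbell lambda n alpha = m n.
Proof.
move=> n0; have D1 := zt_dpoisson_dexp_gt1.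
(* The Bell generating function is D^-1 (1 + (D - 1) E[v^X]); its extra constant D^-1 affects only
   the coefficient of index 0, hence n > 0. *)
pose b k := D^-1 * (D - 1) * m k + D^-1 * (k == 0)%:R.
rewrite /dbell (@egf_coefE _ _ b).
  rewrite /b -(prednK n0)/= mulr0 addr0; field.
  by rewrite -/D subr_eq0 !gt_eqF// (lt_trans _ D1).
apply: filterS cvg_pseries_dfalling_moment => t mt.
have dt : pseries (fun k => (k == 0)%:R / k`!%:R) t @ \oo --> (1 : R).
  rewrite -cvg_shiftS (_ : (fun k => _) = (fun=> 1)); first exact: cvg_cst.
  apply/funext => k; rewrite /pseries /series/= big_nat_recl//= big1.
    by rewrite expr0 fact0 divr1 mulr1 addr0.
  by move=> i _; rewrite !mul0r.
have := @cvg_pseries_lincomb _ _ _ t (D^-1 * (D - 1)) D^-1 _ _ mt dt.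
rewrite (_ : (fun k => _) = (fun k => b k / k`!%:R)); last first.
  by apply/funext => k; rewrite /b; ring.
rewrite -/D [X in _ --> X -> _](_ : _ =
    D^-1 * dexp lambda 1 (alpha * dexp lambda 1 t))//.
by field; rewrite subr_eq0 !gt_eqF// (lt_trans _ D1).
Qed.

Lemma integral_dfalling_zt_dpoisson n : (0 < n)%N ->
  (\int[P]_w (dfalling lambda (X w) n)%:E
    = ((1 - D^-1)^-1 * dbell lambda n alpha)%:E)%E.
Proof.
move=> n0; rewrite dbell_zt_dpoisson// fineK//.
exact: integrable_fin_num (integrable_dfalling n).
Qed.

End zero_truncated_poisson.

(** * From degenerate to ordinary factorial moments *)

Theorem theorem11 (R : realType) (d : measure_display) (T : measurableType d)
    (P : probability T R) (lambda alpha : R) (halpha : 0 < alpha)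
    (X : {RV P >-> R}) (hX : zt_dpoisson lambda alpha X)
    (n : nat) (hn : (0 < n)%N) :
  ('E_P[(fun w => ffalling (X w) n)] =
  ((1 - (dexp lambda 1 alpha)^-1)^-1
   * \sum_(1 <= k < n.+1) dbell lambda k alpha * dstirling1 lambda n k)%:E)%E.
Proof.
have idf k := integrable_dfalling halpha hX k.
rewrite unlock.
under eq_integral do rewrite (ffallingE lambda) -sumEFin.
rewrite integral_sum//; last first.
  by move=> k; under eq_fun do rewrite EFinM; exact: integrableZl.
(* Since n > 0, s(n,0) = 0 removes the index k = 0, the one at which the Bell identity fails. *)
rewrite mulr_sumr -sumEFin [LHS]big_ltn// [X in (X + _)%E](_ : _ = 0%E) ?add0e;
    last first.
  rewrite -(prednK hn) stirling1_recS0.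
  by under eq_integral do rewrite mul0r; rewrite integral0.
apply: eq_big_nat => k /andP[k0 _].
under eq_integral do rewrite EFinM.
rewrite integralZl// (integral_dfalling_zt_dpoisson halpha hX k0) dstirling1E.
by rewrite -EFinM; congr EFin; ring.
Qed.
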